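(* Given $C_f,C_g,D>0$. For any first-order algorithm $\mathcal A$ in the zero-respecting class (defined in the context) and any initial point $x_0$, there exists a $(C_f,C_g)$-Lipschitz instance of the simple bilevel problem on the domain $\mathcal Z=\mathcal B(x_0,D)$ such that the optimal solution $x^*$ is contained in $\mathcal Z$ and $\mathcal A$ needs at least $$\Omega\left(\max\left\{\frac{C_f^2}{\epsilon_f^2},\frac{C_g^2}{\epsilon_g^2}\right\}D^2\right)$$ iterations to find an $(\epsilon_f,\epsilon_g)$-weak optimal solution.
   Context: Simple bilevel problem: minimize $f(x)$ over $x\in \mathcal X_g^*:=\arg\min_{z\in\mathcal Z} g(z)$, where $f,g:\mathbb R^n\to\mathbb R$ are convex and continuous and $\mathcal Z\subseteq\mathbb R^n$ is convex and compact. Let $f^*$ be its optimal value and $g^*=\min_{z\in\mathcal Z}g(z)$. The instance is $(C_f,C_g)$-Lipschitz if $f$ is $C_f$-Lipschitz on $\mathcal Z$ and $g$ is $C_g$-Lipschitz on $\mathcal Z$ (Euclidean norm). For target accuracies $\epsilon_f,\epsilon_g>0$, a point $\hat x$ is an $(\epsilon_f,\epsilon_g)$-weak optimal solution if $f(\hat x)-f^*\le\epsilon_f$ and $g(\hat x)-g^*\le\epsilon_g$. $\mathcal B(x_0,D)=\{y:\|y-x_0\|_2\le D\}$. Zero-respecting class: with $\mathrm{supp}(x)=\{j:x_{[j]}\ne0\}$ (nonzero coordinates), an iterative method $\mathcal A$ can access $f$ and $g$ only through a first-order black-box oracle, which takes a test point $\hat x$ as input and returns $\partial f(\hat x),\partial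 g(\hat x)$, denoting single arbitrary subgradients of $f$ and $g$ at $\hat x$ (the oracle's choice may be adversarial). $\mathcal A$ generates a sequence of test points $x_0,x_1,x_2,\dots$ with $$\mathrm{supp}(x_{k+1})\subseteq \mathrm{supp}(x_0)\cup\left(\bigcup_{0\le s\le k}\mathrm{supp}(\partial f(x_s))\cup\mathrm{supp}(\partial g(x_s))\right).$$ The dimension $n$ is part of the instance and may depend on the accuracies and the other parameters. $\Omega$ is the usual asymptotic lower-bound notation, hiding only a universal constant. *)

(* Defs.v *)
From HB Require Import structures.
From mathcomp Require Import all_boot all_order all_algebra.
From mathcomp Require Import all_classical all_reals all_analysis.

Set Implicit Arguments.
Unset Strict Implicit.
Unset Printing Implicit Defensive.

Import Order.TTheory GRing.Theory Num.Theory.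
Import numFieldNormedType.Exports.

Local Open Scope classical_set_scope.
Local Open Scope ring_scope.

Definition dotv (R : realType) (n : nat) (x y : 'rV[R]_n) : R :=
  \sum_(i < n) x 0 i * y 0 i.

(* The library norm `|x| on row vectors is the sup norm, hence this one. *)
Definition enorm (R : realType) (n : nat) (x : 'rV[R]_n) : R :=
  Num.sqrt (dotv x x).

Definition eball (R : realType) (n : nat) (x0 : 'rV[R]_n) (D : R) :
    set 'rV[R]_n :=
  [set y | enorm (y - x0) <= D].

Definition elipschitz_on (R : realType) (n : nat) (Z : set 'rV[R]_n) (C : R)
    (f : 'rV[R]_n -> R) : Prop :=
  forall x y, Z x -> Z y -> `|f x - f y| <= C * enorm (x - y).

Definition convex_continuous (R : realType) (n : nat) (f : 'rV[R]_n -> R) :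
    Prop :=
  convex_function [set: 'rV[R]_n] f /\ continuous f.

Definition simple_bilevel (R : realType) (n : nat) (f g : 'rV[R]_n -> R)
    (Z : set 'rV[R]_n) : Prop :=
  [/\ convex_continuous f, convex_continuous g, convex_set Z & compact Z].

Definition lipschitz_bilevel (R : realType) (n : nat) (Cf Cg : R)
    (f g : 'rV[R]_n -> R) (Z : set 'rV[R]_n) : Prop :=
  [/\ simple_bilevel f g Z, elipschitz_on Z Cf f & elipschitz_on Z Cg g].

Definition argmin_on (R : realType) (n : nat) (Z : set 'rV[R]_n)
    (h : 'rV[R]_n -> R) : set 'rV[R]_n :=
  [set z | Z z /\ forall y, Z y -> h z <= h y].

Definition bilevel_solution (R : realType) (n : nat) (f g : 'rV[R]_n -> R)
    (Z : set 'rV[R]_n) : set 'rV[R]_n :=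
  argmin_on (argmin_on Z g) f.

Definition lower_value (R : realType) (n : nat) (g : 'rV[R]_n -> R)
    (Z : set 'rV[R]_n) : R :=
  inf (g @` Z).

Definition upper_value (R : realType) (n : nat) (f g : 'rV[R]_n -> R)
    (Z : set 'rV[R]_n) : R :=
  inf (f @` argmin_on Z g).

(* The point x is not required to belong to Z. *)
Definition weak_optimal (R : realType) (n : nat) (f g : 'rV[R]_n -> R)
    (Z : set 'rV[R]_n) (ef eg : R) (x : 'rV[R]_n) : Prop :=
  f x - upper_value f g Z <= ef /\ g x - lower_value g Z <= eg.

Definition subgradient (R : realType) (n : nat) (h : 'rV[R]_n -> R)
    (x u : 'rV[R]_n) : Prop :=
  forall y, h x + dotv u (y - x) <= h y.

(* An oracle fixes one subgradient of f and one of g at every point. *)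
Definition oracle (R : realType) (n : nat) : Type :=
  'rV[R]_n -> 'rV[R]_n * 'rV[R]_n.

Definition first_order_oracle (R : realType) (n : nat) (f g : 'rV[R]_n -> R)
    (o : oracle R n) : Prop :=
  forall x, subgradient f x (o x).1 /\ subgradient g x (o x).2.

(* A deterministic method: it maps the list of the past test points, each with
   the two subgradients received there, to the next test point. *)
Definition algorithm (R : realType) (n : nat) : Type :=
  seq ('rV[R]_n * ('rV[R]_n * 'rV[R]_n)) -> 'rV[R]_n.

(* The queries x_0, ..., x_k with the answers to them, oldest first. *)
Fixpoint transcript (R : realType) (n : nat) (A : algorithm R n)
    (o : oracle R n) (x0 : 'rV[R]_n) (k : nat) :
    seq ('rV[R]_n * ('rV[R]_n * 'rV[R]_n)) :=
  if k is k'.+1 then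
    let h := transcript A o x0 k' in rcons h (A h, o (A h))
  else [:: (x0, o x0)].

Definition test_point (R : realType) (n : nat) (A : algorithm R n)
    (o : oracle R n) (x0 : 'rV[R]_n) (k : nat) : 'rV[R]_n :=
  if k is k'.+1 then A (transcript A o x0 k') else x0.

Definition supp (R : realType) (n : nat) (x : 'rV[R]_n) : {set 'I_n} :=
  [set j | x 0 j != 0]%SET.

Definition zero_respecting (R : realType) (n : nat) (A : algorithm R n) :
    Prop :=
  forall (f g : 'rV[R]_n -> R) (o : oracle R n) (x0 : 'rV[R]_n),
    convex_continuous f -> convex_continuous g -> first_order_oracle f g o ->
    forall k : nat,
      let x := test_point A o x0 in
      supp (x k.+1) \subset
        (supp x0 :|: \bigcup_(s < k.+1)
                       (supp (o (x s)).1 :|: supp (o (x s)).2))%SET.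

(* Main.v *)
Require Import Defs.
From mathcomp Require Import all_boot all_order all_algebra.
From mathcomp Require Import all_classical all_reals all_analysis.
From mathcomp Require Import ring lra.

Set Implicit Arguments.
Unset Strict Implicit.
Unset Printing Implicit Defensive.

Import Order.TTheory GRing.Theory Num.Theory.
Import numFieldNormedType.Exports.

Local Open Scope classical_set_scope.
Local Open Scope ring_scope.

(* Only one of the two objectives is hard, the other one is 0.  The hard one is
   Nemirovski's resisting function C max_i s_i (x - x0)_(j_i), whose coordinates
   j_i and signs s_i are chosen against the method: the k-th query fixes the
   unused coordinate on which x_k - x0 is largest in absolute value, with the
   sign that makes the new term nonnegative at x_k.  Terms chosen later never
   exceed the maximum of the older ones at x_k, so an oracle that prefers older
   terms answers consistently, and the value at each of the first n test points
   is nonnegative, whereas the minimum over the ball is -C D / sqrt n.  This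
   works against every deterministic method, zero-respecting or not; that
   matters, since x0 may have full support. *)

(** * Inner products and the Euclidean ball *)

Lemma dotv0l (R : realType) (n : nat) (x : 'rV[R]_n) : dotv 0 x = 0.
Proof. by rewrite /dotv big1 // => i _; rewrite mxE mul0r. Qed.

Lemma dotv_delta (R : realType) (n : nat) (a : R) (j : 'I_n) (x : 'rV[R]_n) :
  dotv (a *: delta_mx 0 j) x = a * x 0 j.
Proof.
rewrite /dotv (bigD1 j) //= !mxE !eqxx mulr1 big1 ?addr0 // => i neq_ij.
by rewrite !mxE eqxx (negbTE neq_ij) mulr0 mul0r.
Qed.

Lemma dotvDr (R : realType) (n : nat) (u x y : 'rV[R]_n) :
  dotv u (x + y) = dotv u x + dotv u y.
Proof. by rewrite /dotv -big_split; apply: eq_bigr => i _; rewrite mxE mulrDr. Qed.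

Lemma dotvZr (R : realType) (n : nat) (a : R) (u x : 'rV[R]_n) :
  dotv u (a *: x) = a * dotv u x.
Proof. by rewrite /dotv mulr_sumr; apply: eq_bigr => i _; rewrite mxE mulrCA. Qed.

Lemma dotv_ge0 (R : realType) (n : nat) (x : 'rV[R]_n) : 0 <= dotv x x.
Proof. by apply: sumr_ge0 => i _; rewrite -expr2 sqr_ge0. Qed.

Lemma enorm_ge_coord (R : realType) (n : nat) (x : 'rV[R]_n) (j : 'I_n) :
  `|x 0 j| <= enorm x.
Proof.
rewrite -sqrtr_sqr ler_wsqrtr // /dotv (bigD1 j) //= -expr2 lerDl.
by apply: sumr_ge0 => i _; rewrite -expr2 sqr_ge0.
Qed.

Lemma eballE (R : realType) (n : nat) (x0 : 'rV[R]_n) (D : R) : 0 <= D ->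
  eball x0 D = [set y | dotv (y - x0) (y - x0) <= D ^+ 2].
Proof.
move=> D0; apply/seteqP; split=> y; rewrite /eball /enorm /=.
  move=> le_yD; rewrite -(sqr_sqrtr (dotv_ge0 _)).
  by rewrite ler_pXn2r // nnegrE sqrtr_ge0.
by move=> /ler_wsqrtr; rewrite sqrtr_sqr ger0_norm.
Qed.

Lemma convex_eball (R : realType) (n : nat) (x0 : 'rV[R]_n) (D : R) :
  0 <= D -> convex_set (eball x0 D).
Proof.
move=> D0 x y t; rewrite eballE // !inE /= => Bx By.
have -> : D ^+ 2 = t%:num * D ^+ 2 + (1 - t%:num) * D ^+ 2.
  by rewrite -mulrDl addrC subrK mul1r.
have t0 : 0 <= t%:num by [].
have t1 : 0 <= 1 - t%:num by rewrite subr_ge0.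
apply: le_trans (lerD (ler_wpM2l t0 Bx) (ler_wpM2l t1 By)).
rewrite /dotv !mulr_sumr -big_split; apply: ler_sum => i _; rewrite !mxE /=.
move: (t%:num) t0 t1 (x 0 i) (y 0 i) (x0 0 i) => s s0 s1 a b c.
rewrite /unstable.onem -subr_ge0.
(* The convexity defect of a squared coordinate is a nonnegative multiple of a square. *)
have -> : s * ((a - c) * (a - c)) + (1 - s) * ((b - c) * (b - c))
     - (s * a + (1 - s) * b - c) * (s * a + (1 - s) * b - c)
     = s * (1 - s) * (a - b) ^+ 2 by ring.
by rewrite mulr_ge0 ?sqr_ge0 ?mulr_ge0.
Qed.

Lemma continuous_coordB (R : realType) (n : nat) (x0 : 'rV[R]_n) (i : 'I_n) :
  continuous (fun y : 'rV[R]_n => (y - x0) 0 i).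
Proof.
under eq_fun do rewrite !mxE.
move=> x; apply: (cvgB (F := nbhs x)); last exact: cvg_cst.
exact: coord_continuous.
Qed.

Lemma continuous_sqnormB (R : realType) (n : nat) (x0 : 'rV[R]_n) :
  continuous (fun y : 'rV[R]_n => dotv (y - x0) (y - x0)).
Proof.
apply: (continuous_big (op := +%R) (x0 := 0)); first exact: add_continuous.
by move=> i _ x; apply: (cvgM (F := nbhs x)); exact: continuous_coordB.
Qed.

Lemma compact_eball (R : realType) (n : nat) (x0 : 'rV[R]_n) (D : R) :
  0 <= D -> compact (eball x0 D).
Proof.
move=> D0; apply: bounded_closed_compact.
  exists (`|x0| + D); split; first by rewrite num_real.
  move=> M ltM y By; apply: ltW; apply: le_lt_trans ltM.
  rewrite -{1}(subrK x0 y) addrC; apply: le_trans (ler_normD _ _) _.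
  (* Boundedness refers to the sup norm, which [enorm] dominates coordinate by coordinate. *)
  rewrite lerD2l [X in X <= _]/Num.norm /= mx_normrE.
  apply: bigmax_le => // -[i j] _ /=; rewrite [i]ord1.
  exact: le_trans (enorm_ge_coord _ _) By.
rewrite eballE //.
apply: (@preimage_closed _ _ (fun y : 'rV[R]_n => dotv (y - x0) (y - x0))
  [set r | r <= D ^+ 2]).
  by move=> y _; exact: continuous_sqnormB.
exact: closed_le.
Qed.

(** Both subgradient inequalities are taken at the convex combination [z]; in their weighted sum the
    linear terms cancel. *)
Lemma subgradient_convex (R : realType) (n : nat) (h : 'rV[R]_n -> R)
    (u : 'rV[R]_n -> 'rV[R]_n) :
  (forall x, subgradient h x (u x)) -> convex_function [set: 'rV[R]_n] h.
Proof.
move=> subh t x y _ _; rewrite convRE.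
set z : 'rV[R]_n := conv t x y.
have t0 : 0 <= t%:num by [].
have t1 : 0 <= 1 - t%:num by rewrite subr_ge0.
apply: le_trans (lerD (ler_wpM2l t0 (subh z x)) (ler_wpM2l t1 (subh z y))).
rewrite !mulrDr addrACA -mulrDl subrKC mul1r lerDl.
rewrite -!dotvZr -dotvDr.
suff -> : t%:num *: (x - z) + (1 - t%:num) *: (y - z) = 0.
  by rewrite /dotv big1 // => i _; rewrite mxE mulr0.
apply/rowP => i; rewrite /z !mxE /= /unstable.onem; ring.
Qed.

(** * The resisting function and its adversarial construction *)

Section ResistingFunction.
Variables (R : realType) (n : nat) (C v : R) (x0 : 'rV[R]_n).
Implicit Types (p : bool * 'I_n) (L : seq (bool * 'I_n)) (x y : 'rV[R]_n).

Definition signed_coord p x : R := C * ((-1) ^+ p.1 * (x - x0) 0 p.2).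

(* The floor v, set below to the minimum over the ball, makes that minimum
   global. *)
Definition resist L x : R :=
  foldr (fun p m => Num.max (signed_coord p x) m) v L.

(* Newer terms are at the head of L, and ties are resolved for the older ones. *)
Fixpoint resist_subgrad L x : 'rV[R]_n :=
  if L is p :: L' then
    if signed_coord p x <= resist L' x then resist_subgrad L' x
    else (C * (-1) ^+ p.1) *: delta_mx 0 p.2
  else 0.

(** The vector returned is the slope of an affine piece that attains the maximum at [x], and every
    piece minorizes [resist L]. *)
Lemma resist_subgradP L x : subgradient (resist L) x (resist_subgrad L x).
Proof.
elim: L => [|p L IH] y /=; first by rewrite dotv0l addr0.
case: (leP (signed_coord p x) (resist L x)) => _.
  by rewrite le_max IH orbT.
rewrite dotv_delta le_max; apply/orP; left.
rewrite le_eqVlt; apply/orP; left; apply/eqP.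
by rewrite /signed_coord !mxE; ring.
Qed.

Lemma resist_lip1 L x y : 0 <= C -> resist L x <= resist L y + C * enorm (x - y).
Proof.
move=> C0; have N0 : 0 <= C * enorm (x - y) by rewrite mulr_ge0 ?sqrtr_ge0.
elim: L => [|p L IH] /=; first by rewrite lerDl.
rewrite ge_max; apply/andP; split; last first.
  by apply: le_trans IH _; rewrite lerD2r le_max lexx orbT.
apply: (@le_trans _ _ (signed_coord p y + C * enorm (x - y))); last first.
  by rewrite lerD2r le_max lexx.
rewrite -lerBlDl /signed_coord -mulrBr -mulrBr ler_wpM2l //.
apply: le_trans (enorm_ge_coord _ p.2).
apply: le_trans (ler_norm _) _; rewrite normrM normrX normrN1 expr1n mul1r.
by rewrite !mxE opprB addrA subrK.
Qed.

Lemma resist_lip L (Z : set 'rV[R]_n) : 0 <= C -> elipschitz_on Z C (resist L).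
Proof.
move=> C0 x y _ _; rewrite ler_norml; apply/andP; split; last first.
  by rewrite lerBlDl resist_lip1.
rewrite lerBrDl lerBlDr.
have -> : enorm (x - y) = enorm (y - x).
  rewrite /enorm; congr Num.sqrt; apply: eq_bigr => i _; rewrite !mxE; ring.
exact: resist_lip1.
Qed.

Lemma continuous_resist L : continuous (resist L).
Proof.
elim: L => [|p L IH] x; first by exact: (@cvg_cst _ _ _ (nbhs x)).
apply: (@continuous_max _ _ (signed_coord p) (resist L)) (IH x).
apply: (cvgM (F := nbhs x)); first exact: cvg_cst.
apply: (cvgM (F := nbhs x)); first exact: cvg_cst.
exact: continuous_coordB.
Qed.

Lemma resist_convex_continuous L : convex_continuous (resist L).
Proof.
split; last exact: continuous_resist.
exact: subgradient_convex (resist_subgradP L).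
Qed.

Lemma resist_ge L x : v <= resist L x.
Proof. by elim: L => //= p L IH; rewrite le_max IH orbT. Qed.

Lemma resist_eq L x :
  (forall p, p \in L -> signed_coord p x = v) -> resist L x = v.
Proof.
elim: L => //= p L IH Lv; rewrite (Lv p) ?mem_head // IH ?maxxx // => q Lq.
by rewrite Lv // inE Lq orbT.
Qed.

(** Determinism: agreement along the run of [o] alone forces the two runs to coincide. *)
Lemma transcript_congr (A : algorithm R n) (o o' : oracle R n) (k : nat) :
  (forall i, (i <= k)%N ->
     o (test_point A o x0 i) = o' (test_point A o x0 i)) ->
  transcript A o x0 k = transcript A o' x0 k.
Proof.
elim: k => [|k IH] eq_o /=; first by rewrite (eq_o 0%N).
rewrite -IH => [|i le_ik]; last by apply: eq_o; rewrite leqW.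
by rewrite (eq_o k.+1 (leqnn _) : o (A _) = _).
Qed.

(** The bound [i < k] is strict because query [k] is made before its own answer, which may therefore
    still be changed. *)
Lemma test_point_congr (A : algorithm R n) (o o' : oracle R n) (k : nat) :
  (forall i, (i < k)%N ->
     o (test_point A o x0 i) = o' (test_point A o x0 i)) ->
  test_point A o x0 k = test_point A o' x0 k.
Proof.
by case: k => //= k eq_o; rewrite (transcript_congr eq_o).
Qed.

Lemma resisting_terms (A : algorithm R n)
    (w : 'rV[R]_n -> 'rV[R]_n * 'rV[R]_n) (m : nat) :
  0 <= C -> (m <= n)%N ->
  exists L, [/\ size L = m, uniq (unzip2 L) &
    forall k, (k < m)%N ->
      let x := test_point A (w \o resist_subgrad L) x0 k in
      0 <= resist L x /\
      forall j, j \notin unzip2 L -> C * `|(x - x0) 0 j| <= resist L x].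
Proof.
move=> C0; elim: m => [|m IH] le_mn; first by exists [::].
have [L [sL uL invL]] := IH (ltnW le_mn).
pose x := test_point A (w \o resist_subgrad L) x0 m.
have [j0 Lj0] : exists j0, j0 \notin unzip2 L.
  apply/existsP; rewrite -negb_forall; apply/negP => /forallP Lfull.
  suff : (n <= size (unzip2 L))%N by rewrite size_map sL leqNgt le_mn.
  rewrite -[X in (X <= _)%N](card_ord n); apply: leq_trans (card_size _).
  by apply: subset_leq_card; apply/fintype.subsetP => j _; exact: Lfull.
have [j Lj maxj] := @arg_maxP _ _ _ j0 (fun j => j \notin unzip2 L)
  (fun j => `|(x - x0) 0 j|) Lj0.
pose L' := ((x - x0) 0 j < 0, j) :: L.
have newE y : signed_coord ((x - x0) 0 j < 0, j) y <= C * `|(y - x0) 0 j|.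
  rewrite /signed_coord ler_wpM2l // (le_trans (ler_norm _)) // normrM.
  by rewrite normrX normrN1 expr1n mul1r.
have newx : signed_coord ((x - x0) 0 j < 0, j) x = C * `|(x - x0) 0 j|.
  by rewrite /signed_coord /= -normrEsign.
(* At queries before [m] the new term is at most [resist L], so [resist_subgrad] gives the old
   answers, and query [m] depends only on these. *)
have same k : (k <= m)%N ->
    test_point A (w \o resist_subgrad L) x0 k
    = test_point A (w \o resist_subgrad L') x0 k.
  move=> le_km; apply: test_point_congr => i lt_ik /=.
  have [_ /(_ _ Lj)] := invL i (leq_trans lt_ik le_km).
  by move=> /(le_trans (newE _)) ->.
exists L'; split=> /=; [by rewrite sL|by rewrite Lj uL|].
move=> k; rewrite ltnS => le_km; rewrite -same //.
move: le_km; rewrite leq_eqVlt => /orP[/eqP ->|/invL[x_ge0 x_max]].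
  rewrite -/x newx; split; first by rewrite le_max mulr_ge0.
  move=> i; rewrite inE negb_or => /andP[_ Li].
  by rewrite le_max ler_wpM2l //; exact: maxj.
split=> [|i]; first by rewrite le_max x_ge0 orbT.
by rewrite inE negb_or => /andP[_ Li]; rewrite le_max x_max ?orbT.
Qed.

End ResistingFunction.

(** * The hard instance and its minimizer *)

Lemma uniq_unzip2_inj (S T : eqType) (L : seq (S * T)) (a b : S) (j : T) :
  uniq (unzip2 L) -> (a, j) \in L -> (b, j) \in L -> a = b.
Proof.
elim: L => //= -[c i] L IH /andP[Li uL]; rewrite !inE !xpair_eqE.
have Li' d : (d, i) \notin L by apply: contra Li => /(map_f snd).
move=> /orP[/andP[/eqP-> /eqP->]|La] /orP[/andP[/eqP-> /eqP e]|Lb] //.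
- by rewrite (negbTE (Li' b)) in Lb.
- by rewrite e (negbTE (Li' a)) in La.
exact: IH.
Qed.

Lemma resisting_instance (R : realType) (m : nat) (C D : R) (x0 : 'rV[R]_m.+1)
    (A : algorithm R m.+1) (w : 'rV[R]_m.+1 -> 'rV[R]_m.+1 * 'rV[R]_m.+1) :
  0 < C -> 0 < D ->
  exists (h : 'rV[R]_m.+1 -> R) (u : 'rV[R]_m.+1 -> 'rV[R]_m.+1),
  [/\ convex_continuous h, elipschitz_on (eball x0 D) C h,
      forall x, subgradient h x (u x),
      exists z, [/\ eball x0 D z, forall y, h z <= h y
                  & h z = - (C * (D / Num.sqrt m.+1%:R))]
    & forall k, (k < m.+1)%N -> 0 <= h (test_point A (w \o u) x0 k)].
Proof.
move=> C0 D0; pose d := D / Num.sqrt m.+1%:R.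
have [L [_ uL invL]] :=
  resisting_terms (- (C * d)) x0 A w (ltW C0) (leqnn m.+1).
exists (resist C (- (C * d)) x0 L), (resist_subgrad C (- (C * d)) x0 L).
split; [exact: resist_convex_continuous|exact: resist_lip (ltW C0)
       |exact: resist_subgradP| |by move=> k /invL[]].
(* Moving by [d] against every sign brings each term down to the floor; the squared distance to [x0]
   is [m.+1] times [d ^+ 2], that is [D ^+ 2]. *)
pose z := x0 - \row_j (d * (-1) ^+ ((true, j) \in L)).
have zv : resist C (- (C * d)) x0 L z = - (C * d).
  apply: resist_eq => -[b j] Lbj; rewrite /signed_coord /= !mxE.
  (* Coordinates do not repeat in [L], so this membership reads off the sign of the term on [j]. *)
  have -> : ((true, j) \in L) = b.
    case: b Lbj => // Lj; apply/negP => Lj'.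
    by have := uniq_unzip2_inj uL Lj Lj'.
  by rewrite addrC addKr mulrN mulrCA -expr2 sqrr_sign mulr1 mulrN.
exists z; split => //; last by move=> y; rewrite zv resist_ge.
rewrite eballE ?ltW //= /dotv (eq_bigr (fun=> d ^+ 2)) => [|i _]; last first.
  by rewrite !mxE addrC addKr mulrNN mulrACA -!expr2 sqrr_sign mulr1.
rewrite sumr_const card_ord -[_ *+ _]mulr_natr /d expr_div_n sqr_sqrtr //.
by rewrite divfK // pnatr_eq0.
Qed.

(** * The lower bound *)

Lemma inf_attained (R : realType) (S : set R) (a : R) :
  S a -> lbound S a -> inf S = a.
Proof.
move=> Sa lbSa; apply/eqP; rewrite eq_le; apply/andP; split.
  by apply: ge_inf => //; exists a.
by apply: lb_le_inf => //; exists a.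
Qed.

Lemma resisting_gap (R : realType) (C D e : R) (n : nat) :
  0 < C -> 0 < D -> 0 < e -> (0 < n)%N ->
  n%:R < C ^+ 2 / e ^+ 2 * D ^+ 2 -> e < C * (D / Num.sqrt n%:R).
Proof.
move=> C0 D0 e0 n0; rewrite mulrAC ltr_pdivlMr ?exprn_gt0 // => lt_n.
have sn0 : 0 < Num.sqrt n%:R :> R by rewrite sqrtr_gt0 ltr0n.
rewrite mulrA ltr_pdivlMr // -(@ltr_pXn2r _ 2) ?nnegrE ?mulr_ge0 ?ltW //.
by rewrite !exprMn sqr_sqrtr // mulrC.
Qed.

Lemma convex_continuous0 (R : realType) (n : nat) :
  convex_continuous (fun _ : 'rV[R]_n => 0).
Proof.
split; last by move=> x; exact: (@cvg_cst _ _ _ (nbhs x)).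
by apply: (@subgradient_convex _ _ _ (fun=> 0)) => x y; rewrite dotv0l addr0.
Qed.

Lemma subgradient0 (R : realType) (n : nat) (x : 'rV[R]_n) :
  subgradient (fun=> 0) x 0.
Proof. by move=> y; rewrite dotv0l addr0. Qed.

Lemma elipschitz0 (R : realType) (n : nat) (Z : set 'rV[R]_n) (C : R) :
  0 <= C -> elipschitz_on Z C (fun=> 0).
Proof. by move=> C0 x y _ _; rewrite subrr normr0 mulr_ge0 ?sqrtr_ge0. Qed.

(* c is the universal constant hidden by Omega.  The method and its initial
   point are given in every dimension, since the dimension n belongs to the
   instance.  N counts the test points x_0, ..., x_(N-1) generated so far. *)
Theorem theorem5p2 (R : realType) :
  exists2 c : R, 0 < c &
    forall Cf Cg D ef eg : R,
      0 < Cf -> 0 < Cg -> 0 < D -> 0 < ef -> 0 < eg ->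
    forall (A : forall n : nat, algorithm R n) (x0 : forall n : nat, 'rV[R]_n),
      (forall n : nat, zero_respecting (A n)) ->
    exists (n : nat) (f g : 'rV[R]_n -> R) (o : oracle R n),
      let Z := eball (x0 n) D in
      [/\ (0 < n)%N,
          lipschitz_bilevel Cf Cg f g Z,
          first_order_oracle f g o,
          exists2 xstar : 'rV[R]_n, bilevel_solution f g Z xstar & Z xstar
        & forall N : nat,
            (exists2 k : nat, (k < N)%N &
               weak_optimal f g Z ef eg (test_point (A n) o (x0 n) k)) ->
            c * (Num.max (Cf ^+ 2 / ef ^+ 2) (Cg ^+ 2 / eg ^+ 2) * D ^+ 2)
              <= N%:R].
Proof.
exists 2^-1 => // Cf Cg D ef eg Cf0 Cg0 D0 ef0 eg0 A x0 _.
(* For [t > 0], the factor 1/2 makes [t] strictly smaller than [M * D ^+ 2], as [resisting_gap]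
   requires, while [t + 1] still exceeds the claimed bound. *)
set M := Num.max _ _; pose t := Num.truncn (2^-1 * (M * D ^+ 2)).
have M0 : 0 < M by rewrite lt_max divr_gt0 ?exprn_gt0.
have T0 : 0 < M * D ^+ 2 by rewrite mulr_gt0 ?exprn_gt0.
have /truncn_itv/andP[le_t lt_t] : 0 <= 2^-1 * (M * D ^+ 2) by rewrite mulr_ge0 ?ltW.
(* For t = 0 the dimension is 1 and the bound is just 1 <= N. *)
have bound (bad : nat -> Prop) :
    (forall k, (k < t)%N -> ~ bad k) ->
    forall N, (exists2 k, (k < N)%N & bad k) -> 2^-1 * (M * D ^+ 2) <= N%:R.
  move=> good N [k lt_kN badk]; apply: le_trans (ltW lt_t) _.
  rewrite ler_nat; apply: leq_trans lt_kN; rewrite ltnS leqNgt.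
  by apply/negP => /good.
(* The dimension is the maximum of [t] and 1; a [k < t] exists only for positive [t], where it
   equals [t]. *)
have dim k : (k < t)%N -> t.-1.+1%:R < M * D ^+ 2.
  move=> lt_kt; rewrite prednK ?(leq_ltn_trans _ lt_kt) //.
  by apply: le_lt_trans le_t _; rewrite gtr_pMl // invf_lt1 ?ltr1n.
pose B := eball (x0 t.-1.+1) D.
have cvxB : convex_set B by apply: convex_eball; exact: ltW.
have cptB : compact B by apply: compact_eball; exact: ltW.
(* The ratio attaining the maximum decides which objective is hard. Here it is the upper one: a
   constant lower objective makes the whole ball feasible. *)
have [ME|MN] := eqVneq M (Cf ^+ 2 / ef ^+ 2).
  have [h [u [h_cc h_lip h_sub [z [Zz h_min hz]] h_ge0]]] :=
    resisting_instance (x0 t.-1.+1) (A _) (fun s => (s, 0)) Cf0 D0.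
  have g_min y : B y ->
      argmin_on B (fun=> 0 : R) y by [].
  exists t.-1.+1, h, (fun=> 0), (fun x => (u x, 0)); split => //.
  - split=> //; last exact: elipschitz0 (ltW Cg0).
    by split => //; exact: convex_continuous0.
  - by move=> x; split => //; exact: subgradient0.
  - by exists z.
  apply: bound => k lt_kt [weak _].
  have vE : upper_value h (fun=> 0 : R) B = h z.
    apply: inf_attained; first by exists z => //; exact: g_min.
    by move=> _ [y _ <-].
  have := resisting_gap Cf0 D0 ef0 (ltn0Sn _) (_ : t.-1.+1%:R < _).
  rewrite -ME => /(_ (dim _ lt_kt)); rewrite -[X in _ < X]opprK -hz -vE.
  (* A nonnegative value at the query, against an optimal value below [- ef], contradicts weak
     optimality. *)
  have := h_ge0 k (leq_trans lt_kt (leqSpred t)).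
  by move: weak; rewrite /comp; lra.
have {MN}ME : M = Cg ^+ 2 / eg ^+ 2.
  by move: MN; rewrite /M; case: leP => //; rewrite eqxx.
(* Now the lower objective is hard; as [f] is 0, any minimizer of [h] over the ball solves the
   bilevel problem. *)
have [h [u [h_cc h_lip h_sub [z [Zz h_min hz]] h_ge0]]] :=
  resisting_instance (x0 t.-1.+1) (A _) (fun s => (0, s)) Cg0 D0.
exists t.-1.+1, (fun=> 0), h, (fun x => (0, u x)); split => //.
- split=> //; last exact: elipschitz0 (ltW Cf0).
  by split => //; exact: convex_continuous0.
- by move=> x; split => //; exact: subgradient0.
- by exists z.
apply: bound => k lt_kt [_ weak].
have vE : lower_value h B = h z.
  by apply: inf_attained; [exists z|move=> _ [y _ <-]].
have := resisting_gap Cg0 D0 eg0 (ltn0Sn _) (_ : t.-1.+1%:R < _).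
rewrite -ME => /(_ (dim _ lt_kt)); rewrite -[X in _ < X]opprK -hz -vE.
have := h_ge0 k (leq_trans lt_kt (leqSpred t)).
by move: weak; rewrite /comp; lra.
Qed.
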